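(* Let $(\Omega,\mathcal{F})$ be a measurable space, let $X$ be a finite dimensional Banach space with $B_1$ separable, and let $T:\Omega\times B_1\to E(X,B_1)$ be a random operator. Suppose that, for each $\omega\in\Omega$, $T(\omega,\cdot)$ is lower semicontinuous, condensing, with nonempty values, and that the inverse $(T(\omega,\cdot))^{-1}$ is closed valued, i.e. $\{x\in B_1: y\in T(\omega,x)\}$ is closed for every $y\in X$. In addition, suppose that for each $\omega\in\Omega$ and each $x\in\partial B_1$ with $x\notin T(\omega,x)$, $T(\omega,\cdot)$ satisfies one of the following conditions: (i) for each $y\in T(\omega,x)$, $\|y-z\|<\|y-x\|$ for some $z\in\overline{I_{B_1}(x)}$; (ii) for each $y\in T(\omega,x)$, there exists $\lambda$ with $|\lambda|<1$ such that $\lambda x+(1-\lambda)y\in\overline{I_{B_1}(x)}$; (iii) $T(\omega,x)\subseteq\overline{I_{B_1}(x)}$; (iv) for each $\lambda\in(0,1)$, $x\notin\lambda T(\omega,x)$; (v) for each $y\in T(\omega,x)$, there exists $\gamma\in(1,\infty)$ such that $\|y\|^{\gamma}-1\le\|y-x\|^{\gamma}$; (vi) for each $y\in T(\omega,x)$, there exists $\beta\in(0,1)$ such that $\|y\|^{\beta}-1\ge\|y-x\|^{\beta}$. Then $T$ has a random fixed point.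
   Context: $B_1=\{x\in X:\|x\|\le 1\}$ and $\partial B_1=\{x\in X:\|x\|=1\}$. For $x\in X$, $B(x,r)=\{y\in X:\|y-x\|<r\}$, and $E(X,B_1)=\{B(x,r)\subset X: x\in B_1,\ r\ge 0\}$; so each value $T(\omega,x)$ is a subset of $X$ of the form $B(c,r)$ with $c\in B_1$. The inward set of $C\subseteq X$ at $x$ is $I_C(x)=\{x+r(y-x): y\in C,\ r\ge 0\}$; the bar denotes closure. $2^{X}$ is the set of nonempty subsets of $X$; for $F:B_1\to 2^{X}$ and $A\subseteq B_1$, $F(A)=\bigcup_{x\in A}F(x)$. Random operator: for each $x\in B_1$, $T(\cdot,x)$ is (lower) measurable, i.e. $\{\omega\in\Omega: T(\omega,x)\cap V\neq\emptyset\}\in\mathcal{F}$ for every open $V\subseteq X$. Lower semicontinuous: $F:B_1\to 2^{X}$ is lower semicontinuous if for each $x\in B_1$ and each open $V\subseteq X$ with $F(x)\cap V\neq\emptyset$ there is an open neighborhood $U$ of $x$ in $B_1$ with $F(y)\cap V\neq\emptyset$ for each $y\in U$. Condensing: let $\gamma(\cdot)$ be the Kuratowski measure of noncompactness: for bounded $A\subseteq X$, $\gamma(A)=\inf\{e>0: A$ is covered by a finite number of sets of diameter $\le e\}$, and $\gamma(A)=\infty$ if $A$ is unbounded. $F:B_1\to 2^{X}$ is condensing if $\gamma(F(A))<\gamma(A)$ for each $A\subseteq B_1$ with $\gamma(A)>0$. (In condition (v), $\gamma$ is just a real number.) Random fixed point of $T$: a measurable mapping $\xi:\Omega\to B_1$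 with $\xi(\omega)\in T(\omega,\xi(\omega))$ for every $\omega\in\Omega$. *)

(* Defs.v *)
From mathcomp Require Import all_boot all_order all_algebra.
From mathcomp Require Import all_classical all_reals all_analysis.
Set Implicit Arguments.
Unset Strict Implicit.
Unset Printing Implicit Defensive.
Import Order.TTheory GRing.Theory Num.Theory.
Import numFieldNormedType.Exports.
Local Open Scope classical_set_scope.
Local Open Scope ring_scope.

Definition finite_dimensional (R : realType) (X : normedModType R) : Prop :=
  exists (n : nat) (e : 'I_n -> X),
    forall x : X, exists a : 'I_n -> R, x = \sum_(i < n) a i *: e i.

Definition separable (X : topologicalType) (A : set X) : Prop :=
  exists D : set X, [/\ countable D, D `<=` A & A `<=` closure D].

Section ball_valued_maps.
Context {R : realType} {X : normedModType R}.

Definition unit_ball : set X := [set x | `|x| <= 1].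

Definition unit_sphere : set X := [set x | `|x| = 1].

(* [ball c r] is the open ball, which is empty for [r = 0]. *)
Definition balls_centered_in (A : set X) : set (set X) :=
  [set S | exists c r, [/\ A c, 0 <= r & S = ball c r]].

Definition inward_set (C : set X) (x : X) : set X :=
  [set z | exists y r, [/\ C y, 0 <= r & z = x + r *: (y - x)]].

(* The diameter of [set0] is [-oo]. *)
Definition diameter (A : set X) : \bar R :=
  ereal_sup [set (`|p.1 - p.2|)%:E | p in A `*` A].

Definition kuratowski (A : set X) : \bar R :=
  if `[< bounded_set A >] then
    ereal_inf [set e%:E | e in [set e : R | 0 < e /\
      exists C : set (set X), [/\ finite_set C, A `<=` \bigcup_(S in C) S &
        forall S, C S -> (diameter S <= e%:E)%E]]]
  else +oo%E.

(* A set-valued map on the unit ball is given by a function on the whole of [X];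
   its values outside the unit ball are never used. *)

Definition lower_semicontinuous_on_ball (F : X -> set X) : Prop :=
  forall x, unit_ball x ->
  forall V : set X, open V -> F x `&` V !=set0 ->
  exists U : set X, [/\ open U, U x &
    forall y, unit_ball y -> U y -> F y `&` V !=set0].

Definition condensing (F : X -> set X) : Prop :=
  forall A : set X, A `<=` unit_ball -> (0 < kuratowski A)%E ->
    (kuratowski (\bigcup_(x in A) F x) < kuratowski A)%E.

Definition closed_valued_inverse (F : X -> set X) : Prop :=
  forall y : X, closed (unit_ball `&` [set x | F x y]).

Definition random_operator (d : measure_display) (Omega : measurableType d)
    (T : Omega -> X -> set X) : Prop :=
  forall x, unit_ball x ->
  forall V : set X, open V -> measurable [set w | T w x `&` V !=set0].

(* Measurability is with respect to the Borel sigma-algebra of [X]; since [xi]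
   takes its values in the unit ball, this is the same as measurability with
   respect to the Borel sigma-algebra of the unit ball. *)
Definition random_fixed_point (d : measure_display) (Omega : measurableType d)
    (T : Omega -> X -> set X) (xi : Omega -> X) : Prop :=
  [/\ forall w, unit_ball (xi w),
      measurable_fun setT (xi : Omega -> g_sigma_algebraType (@open X)) &
      forall w, T w (xi w) (xi w)].

End ball_valued_maps.

(* Main.v *)
(* A ball contains [y] as soon as it meets every small ball centred at the points
   of a finite net of a small sphere around [y]. Lower semicontinuity therefore
   makes each fibre [{x | y \in T(w, x)}] relatively open in the unit ball; being
   also closed, it is empty or the whole unit ball, since the latter is
   connected. Hence [T(w, .)] is constant, equal to a ball [S w] whose centre,
   which lies in the unit ball, is a fixed point. By the same criterion
   [{w | y \in S w}] is measurable, so the first point of a countable dense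
   sequence that falls in [S w] is a measurable choice. *)

Require Import Defs.
From mathcomp Require Import all_boot all_order all_algebra.
From mathcomp Require Import all_classical all_reals all_analysis.
From mathcomp Require Import finmap lra.
Import Order.TTheory GRing.Theory Num.Theory.
Import numFieldNormedType.Exports.
Local Open Scope classical_set_scope.
Local Open Scope ring_scope.

(** * Compactness of the unit ball in finite dimension *)

(** Otherwise the complements are open and dense, and by Baire's theorem they share a point, which
    no [K k] contains. *)
Lemma bigcup_closed_interior {R : realType} {X : completeNormedModType R}
    (K : (set X)^nat) :
  (forall k, closed (K k)) -> (forall x, exists k, K k x) ->
  exists k, exists x : X, nbhs x (K k).
Proof.
move=> Kcl Kcov; apply: contrapT => noint.
have KC i : open (~` K i) /\ dense (~` K i).
  split; first exact: closed_openC.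
  move=> O [x Ox] Oop; apply: contrapT => OKi; apply: noint; exists i, x.
  apply: (@filterS _ _ _ O); last exact: open_nbhs_nbhs.
  by move=> y Oy; apply: contrapT => nKy; apply: OKi; exists y.
have [|x [_ nKx]] := Baire KC _ openT; first by exists 0.
by have [k Kkx] := Kcov x; exact: (nKx k I).
Qed.

Lemma linear_combination_continuous {R : realType} {X : normedModType R}
    (n : nat) (e : 'I_n -> X) :
  continuous (fun a : 'rV[R]_n => \sum_(i < n) a ord0 i *: e i).
Proof.
apply: continuous_big => [|i _ a]; first exact: add_continuous.
by apply: (@cvgZr_tmp _ _ _ (nbhs a)); exact: coord_continuous.
Qed.

(** The spanning family may be dependent, so coordinates give no norm comparison. Instead [X] is the
    union of the compact images [K k] of growing cubes; one of them contains a ball, which is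
    translated and rescaled to cover the unit ball. *)
Lemma finite_dimensional_unit_ball_subcompact {R : realType}
    {X : completeNormedModType R} :
  finite_dimensional X ->
  exists2 C : set X, compact C & unit_ball `<=` C.
Proof.
move=> [n [e span]].
pose f (a : 'rV[R]_n) : X := \sum_(i < n) a ord0 i *: e i.
pose K k := f @` [set a : 'rV[R]_n | forall i, `[- k%:R, k%:R]%classic (a ord0 i)].
have Kco k : compact (K k).
  apply: continuous_compact.
    by apply: continuous_subspaceT; exact: linear_combination_continuous.
  by apply: (@rV_compact _ _ (fun=> _)) => _; exact: segment_compact.
have [k [x /nbhs_ballP[r /= r0 rK]]] : exists k, exists x : X, nbhs x (K k).
  apply: bigcup_closed_interior => [k|x].
    by apply: compact_closed (Kco k); exact: norm_hausdorff.
  have [a ->] := span x.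
  have [M aM] : exists M, forall i, `|a i| <= M.
    exists (\sum_i `|a i|) => // i.
    by rewrite (bigD1 i)//= lerDl sumr_ge0.
  have Mk : M <= (Num.truncn M).+1%:R by exact/ltW/truncnS_gt.
  exists (Num.truncn M).+1; exists (\row_i a i).
    by move=> i; rewrite mxE /= in_itv /= -ler_norml (le_trans (aM i)).
  by apply: eq_bigr => i _; rewrite mxE.
exists ((fun z => (2 / r) *: (z - x)) @` K k).
  apply: continuous_compact (Kco k); apply: continuous_subspaceT => z.
  by apply: (@cvgZl_tmp _ _ _ (nbhs z)); apply: cvgB; [exact: cvg_id|exact: cvg_cst].
(* Half the radius [r] keeps the preimage of [u] inside the open ball even when [u] has norm 1. *)
move=> u /= u1; exists (x + (r / 2) *: u).
  apply: rK; rewrite -ball_normE /= opprD addNKr normrN normrZ gtr0_norm ?divr_gt0//.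
  have r2 : r / 2 < r by rewrite ltr_pdivrMr// ltr_pMr// ltr1n.
  by apply: le_lt_trans r2; rewrite ler_piMr// divr_ge0// ltW.
rewrite addrC addKr scalerA mulrA divfK ?gt_eqF// divff ?scale1r//.
Qed.

(** * Membership in a ball tested on a finite net *)

(** Finiteness keeps intersections indexed by the net open or measurable. *)
Definition half_net {R : realType} {X : normedModType R} (N : {fset X}) : Prop :=
  {subset N <= @unit_ball R X} /\
  forall u : X, unit_ball u -> exists2 v, v \in N & `|u - v| < 2^-1.

Lemma finite_dimensional_half_net {R : realType}
    {X : completeNormedModType R} :
  finite_dimensional X ->
  exists N : {fset X}, half_net N.
Proof.
move=> /finite_dimensional_unit_ball_subcompact[C Cco BC].
have Bco : compact (@unit_ball R X).
  apply: subclosed_compact Cco BC.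
  rewrite (_ : unit_ball = closed_ball_ Num.norm 0 1).
    exact: closed_closed_ball_.
  by apply/seteqP; split=> x; rewrite /unit_ball /closed_ball_ /= sub0r normrN.
move: Bco; rewrite compact_cover.
move=> /(_ _ unit_ball (fun v => ball v 2^-1)).
case=> [v _|u Bu|N NB cov]; first exact: ball_open.
  by exists u => //; apply: ballxx; rewrite invr_gt0.
exists N; split => // u /cov[v /= vN]; rewrite -ball_normE /= distrC => uv.
by exists v.
Qed.

(* If [d <> c], the net vector [v] closest to the direction of [d - c] is such
   that every point near [d + s *: v] is further away from [c] than [d]. *)
Lemma ball_meets_net {R : realType} {X : normedModType R} (N : {fset X})
    (c d : X) (r s : R) :
  half_net N -> 0 < s ->
  (forall v, v \in N -> ball c r `&` ball (d + s *: v) (s / 4) !=set0) ->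
  ball c r d.
Proof.
move=> [_ Nnet] s0 meet; rewrite -ball_normE /=.
have [->|dc] := eqVneq d c.
  (* Only [0 < r] is at stake here: a net vector exists, so [ball c r] is met and hence nonempty. *)
  have [|v /meet[p [+ _]] _] := Nnet 0; first by rewrite /unit_ball /= normr0.
  by rewrite subrr normr0 -ball_normE /=; exact: le_lt_trans.
have dc0 : d - c != 0 by rewrite subr_eq0.
set u := `|d - c|^-1 *: (d - c).
have u1 : `|u| = 1 by exact: normfZV.
have [|v vN uv] := Nnet u; first by rewrite /unit_ball /= u1.
have [p []] := meet v vN; rewrite -!ball_normE /= => pr ps.
apply: lt_trans pr; rewrite !(distrC c).
have norm_dcu : `|(d - c) + s *: u| = `|d - c| + s.
  have -> : (d - c) + s *: u = (`|d - c| + s) *: u.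
    by rewrite scalerDl /u [in RHS]scalerA divff ?normr_eq0// scale1r.
  by rewrite normrZ u1 mulr1 ger0_norm// addr_ge0// ltW.
have svu : `|s *: (u - v)| < s / 2 by rewrite normrZ gtr0_norm// ltr_pM2l.
have split_dcu : (d - c) + s *: u = (p - c) + (s *: (u - v) + (d + s *: v - p)).
  rewrite scalerBr (addrC d (s *: v)) -(addrA (s *: v)) subrKA.
  by rewrite [LHS]addrC [RHS]addrC -[RHS]addrA subrKA.
(* Together these give [|d - c| + s < |p - c| + s / 2 + s / 4], hence [|d - c| < |p - c|]. *)
have := ler_normD (p - c) (s *: (u - v) + (d + s *: v - p)).
have := ler_normD (s *: (u - v)) (d + s *: v - p).
rewrite -split_dcu norm_dcu; lra.
Qed.

(** The right-hand side is a countable union of finite intersections of conditions that a ball meets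
    an open set, the kind that lower semicontinuity and measurability control. *)
Lemma ball_meets_netP {R : realType} {X : normedModType R} (N : {fset X})
    (c d : X) (r : R) :
  half_net N ->
  ball c r d <-> exists k : nat, forall v, v \in N ->
    ball c r `&` ball (d + k.+1%:R^-1 *: v) (k.+1%:R^-1 / 4) !=set0.
Proof.
move=> Nnet; split=> [|[k]]; last exact: ball_meets_net.
rewrite -ball_normE /= -subr_gt0 => rho0.
(* Choosing [1 / (k + 1) < r - |c - d|] puts the centres of the small balls themselves in
   [ball c r], as net vectors have norm at most 1. *)
have /cvgr0_norm_lt := @cvg_harmonic R; move=> /(_ _ rho0)[k _ /(_ k (leqnn k))].
rewrite /= ger0_norm ?harmonic_ge0// /harmonic => kr.
exists k => v /(proj1 Nnet v)/set_mem v1.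
have k0 : (0 : R) < k.+1%:R^-1 by rewrite invr_gt0.
exists (d + k.+1%:R^-1 *: v); split; rewrite /= ?subrr ?normr0 ?divr_gt0//.
rewrite opprD addrA (le_lt_trans (ler_normB _ _))//.
rewrite normrZ gtr0_norm// -ltrBrDl; apply: le_lt_trans kr.
by rewrite ler_piMr// ltW.
Qed.

(** * Constancy on the connected unit ball *)

(** The ball is star-shaped: a union of segments issuing from [0]. *)
Lemma unit_ball_connected {R : realType} {X : normedModType R} :
  connected (@unit_ball R X).
Proof.
have -> : @unit_ball R X =
    \bigcup_(x in unit_ball) ((fun t : R => t *: x) @` `[0, 1]).
  apply/seteqP; split=> [x x1|_ [x x1 [t + <-]]]; first exists x => //.
    by exists 1; rewrite ?scale1r//= in_itv /= ler01 lexx.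
  rewrite /= in_itv => /andP[t0 t1]; rewrite /unit_ball /= normrZ ger0_norm//.
  by rewrite mulr_ile1.
apply: bigcup_connected => [|x _].
  by exists 0 => x _; exists 0; rewrite ?scale0r//= in_itv /= lexx ler01.
apply: connected_continuous_connected; first exact: segment_connected.
by apply: continuous_subspaceT => t; apply: cvgZl; exact: cvg_id.
Qed.

Lemma lsc_closed_inverse_constant {R : realType} {X : completeNormedModType R}
    (F : X -> set X) :
  finite_dimensional X ->
  (forall x, unit_ball x -> balls_centered_in unit_ball (F x)) ->
  lower_semicontinuous_on_ball F -> closed_valued_inverse F ->
  forall x x', unit_ball x -> unit_ball x' -> F x = F x'.
Proof.
move=> /finite_dimensional_half_net[N Nnet] Fball Flsc Finv.
suff sub x x' : unit_ball x -> unit_ball x' -> F x `<=` F x'.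
  by move=> x x' Bx Bx'; apply/seteqP; split; exact: sub.
move=> Bx Bx' y Fxy; suff : unit_ball `&` [set z | F z y] = unit_ball.
  by move/seteqP => [_ /(_ _ Bx')[]].
apply: unit_ball_connected; first by exists x.
  (* The implication admits every point outside the unit ball, so the trace of [U] on the unit ball
     is the relative interior of the fibre of [y]. *)
  pose U := [set z | unit_ball z -> F z y]^°.
  exists U; first exact: open_interior.
  apply/seteqP; split=> z [Bz]; last first.
    by move=> /interior_subset/(_ Bz).
  move=> /= Fzy; split => //; rewrite /U /interior /=.
  have [c [r [_ _ Fzcr]]] := Fball z Bz.
  move: Fzy; rewrite Fzcr => /(ball_meets_netP _ _ _ _ Nnet)[k meet].
  pose V v := ball (y + k.+1%:R^-1 *: v) (k.+1%:R^-1 / 4).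
  (* The index [k] found at [z] is kept: each of the finitely many net conditions persists near [z]
     by lower semicontinuity. *)
  have near_meet : \forall z' \near z, unit_ball z' ->
      (\bigcap_(v in [set` N]) [set z'' | F z'' `&` V v !=set0]) z'.
    apply: filter_bigI_within => v vN.
    have [|W [Wop Wz Wmeet]] := Flsc z Bz (V v) (@ball_open _ _ _ _).
      by rewrite Fzcr; exact: meet.
    apply: (@filterS _ _ _ W); last exact: open_nbhs_nbhs.
    by move=> z' Wz' Bz'; exact: Wmeet.
  apply: filterS near_meet => z' + Bz' => /(_ Bz') meet'.
  have [c' [r' [_ _ Fz'cr]]] := Fball z' Bz'.
  rewrite /= Fz'cr; apply/(ball_meets_netP _ _ _ _ Nnet).
  by exists k => v vN; rewrite -Fz'cr; exact: meet'.
exists (unit_ball `&` [set z | F z y]); first exact: Finv.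
by rewrite setIA setIid.
Qed.

(** * Measurable selection *)

Lemma measurable_preimage_ball_valued {R : realType}
    {X : completeNormedModType R} {d : measure_display}
    {Omega : measurableType d} (S : Omega -> set X) :
  finite_dimensional X ->
  (forall w, exists c r, S w = ball c r) ->
  (forall V : set X, open V -> measurable [set w | S w `&` V !=set0]) ->
  forall y, measurable [set w | S w y].
Proof.
move=> /finite_dimensional_half_net[N Nnet] Sball Smeas y.
have -> : [set w | S w y] = \bigcup_k \bigcap_(v in [set` N])
    [set w | S w `&` ball (y + k.+1%:R^-1 *: v) (k.+1%:R^-1 / 4) !=set0].
  apply/seteqP; split=> w /=; have [c [r Sw]] := Sball w.
    rewrite Sw => /(ball_meets_netP _ _ _ _ Nnet)[k meet].
    by exists k => // v vN; rewrite /= Sw; exact: meet.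
  move=> [k _ meet]; rewrite Sw; apply/(ball_meets_netP _ _ _ _ Nnet).
  by exists k => v vN; rewrite -Sw; exact: meet.
apply: bigcupT_measurable => k; apply: fin_bigcap_measurable => // v _.
by apply: Smeas; exact: ball_open.
Qed.

(** [xi] follows the least index that hits, so it takes countably many values and its preimages are
    countable unions of level sets of [nu]. *)
Lemma measurable_first_hit {d d' : measure_display} {Omega : measurableType d}
    {X : measurableType d'} (S : Omega -> set X) (u : nat -> X) :
  (forall y, measurable [set w | S w y]) ->
  (forall w, exists n, S w (u n)) ->
  exists2 xi : Omega -> X, measurable_fun setT xi &
    forall w, exists n, xi w = u n /\ S w (u n).
Proof.
move=> Smeas hit.
have hitb w : exists n, `[< S w (u n) >].
  by have [n Sn] := hit w; exists n; exact/asboolP.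
pose nu w := ex_minn (hitb w).
have nuE n : [set w | nu w = n] = [set w | S w (u n)] `&`
    \bigcap_(m in `I_n) ~` [set w | S w (u m)].
  apply/seteqP; split=> w /=; rewrite /nu; case: ex_minnP => k /asboolP Sk kmin.
    move=> <-; split => // m /= mk Sm.
    by move: mk; rewrite ltnNge kmin//; exact/asboolP.
  move=> [Sn nS]; apply/eqP; rewrite eqn_leq kmin ?andbT; last exact/asboolP.
  by rewrite leqNgt; apply/negP => kn; exact: nS kn Sk.
exists (fun w => u (nu w)).
  move=> _ Y _; rewrite setTI.
  have -> : (fun w => u (nu w)) @^-1` Y =
      \bigcup_(n in [set n | Y (u n)]) [set w | nu w = n].
    by apply/seteqP; split=> w /=; [exists (nu w)|case=> n /= Yn ->].
  apply: bigcup_measurable => n _; rewrite nuE; apply: measurableI => //.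
  apply: fin_bigcap_measurable => // m _; exact: measurableC.
move=> w; exists (nu w); split => //.
by rewrite /nu; case: ex_minnP => k /asboolP.
Qed.

Theorem corollary3 (R : realType) (X : completeNormedModType R)
    (d : measure_display) (Omega : measurableType d)
    (T : Omega -> X -> set X)
    (fdX : finite_dimensional X)
    (sepB : separable (@unit_ball R X))
    (TE : forall (w : Omega) (x : X), unit_ball x ->
       balls_centered_in unit_ball (T w x))
    (Trandom : random_operator T)
    (Tlsc : forall w : Omega, lower_semicontinuous_on_ball (T w))
    (Tcond : forall w : Omega, condensing (T w))
    (Tne : forall (w : Omega) (x : X), unit_ball x -> T w x !=set0)
    (Tinv : forall w : Omega, closed_valued_inverse (T w))
    (Tbd : forall (w : Omega) (x : X), unit_sphere x -> ~ T w x x ->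
       (* (i) *)
       (forall y, T w x y ->
          exists2 z, closure (inward_set unit_ball x) z & `|y - z| < `|y - x|) \/
       (* (ii) *)
       (forall y, T w x y ->
          exists2 l : R, `|l| < 1 &
            closure (inward_set unit_ball x) (l *: x + (1 - l) *: y)) \/
       (* (iii) *)
       (T w x `<=` closure (inward_set unit_ball x)) \/
       (* (iv) *)
       (forall l : R, 0 < l < 1 -> ~ [set l *: y | y in T w x] x) \/
       (* (v) *)
       (forall y, T w x y ->
          exists2 g : R, 1 < g & `|y| `^ g - 1 <= `|y - x| `^ g) \/
       (* (vi) *)
       (forall y, T w x y ->
          exists2 b : R, 0 < b < 1 & `|y| `^ b - 1 >= `|y - x| `^ b)) :
  exists xi : Omega -> X, random_fixed_point T xi.
Proof.
pose S w := T w 0.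
have B0 : @unit_ball R X 0 by rewrite /unit_ball /= normr0.
have TS w x : unit_ball x -> T w x = S w.
  by move=> Bx; apply: lsc_closed_inverse_constant => //; exact: TE.
have Smeas y : measurable [set w | S w y].
  apply: measurable_preimage_ball_valued => // [w|V Vop].
    by have [c [r [_ _ Swcr]]] := TE w 0 B0; exists c, r.
  exact: Trandom.
have [D [Dcount DB BD]] := sepB.
have Dhit w : exists2 x, D x & S w x.
  have [c [r [Bc _ Swcr]]] := TE w 0 B0.
  (* Nonemptiness gives [0 < r], so [S w] is a neighbourhood of its centre [c], a point of the unit
     ball, and [D] meets it. *)
  have := Tne w 0 B0; rewrite Swcr => -[z czr].
  have r0 : 0 < r by move: czr; rewrite -ball_normE; exact: le_lt_trans.
  have [x [Dx cx]] := BD c Bc _ (nbhsx_ballx c r r0).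
  by exists x => //; rewrite /S Swcr.
have [u Du] : exists u, set_surj [set: nat] D u by exact/pcard_surjP.
(* [u] covers [D] but may also take values outside the unit ball, so the selection is made from
   [S w] cut down to the unit ball. *)
have SBmeas y : measurable [set w | (S w `&` unit_ball) y].
  have [By|nBy] := pselect (unit_ball y); last first.
    by rewrite (_ : mkset _ = set0)//; apply/seteqP; split=> w [].
  rewrite (_ : mkset _ = [set w | S w y])//.
  by apply/seteqP; split=> w /= => [[]|].
have [|w|xi xim xiS] := @measurable_first_hit _ _ Omega
    (g_sigma_algebraType (@open X)) (fun w => S w `&` unit_ball) u.
- exact: SBmeas.
- by have [x Dx Swx] := Dhit w; have [n _ un] := Du x Dx; exists n;
    rewrite un; split => //; exact: DB.
exists xi; split=> [w||w] => //; have [n [-> [Sun Bun]]] := xiS w => //.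
(* By constancy [S w] is also the value of [T w] at the selected point. *)
by rewrite TS.
Qed.
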